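(* Consider the parallel Schwarz method with Robin transmission conditions for the two-dimensional Helmholtz wave-guide problem described in the context. If $\alpha=ik$ (the case of classical impedance conditions), then for all $k>0$, $\sigma>0$, $\delta>0$ and $L>0$ we have that $R_{1d}^{\mathrm H}(\tilde k)<1$ for all evanescent modes $\tilde k>k$. Furthermore, under the assumption that between them $\sigma$, $\delta$ and $L$ are sufficiently large we have that $R_{2d}^{\mathrm H}<1$. In particular, this is true when $\sigma\ge k$ for all $\delta>0$ and $L>0$. Therefore the convergence will ultimately be independent of the number of subdomains (we say that the Schwarz method will scale).
   Context: Domain $\Omega=(a_1,b_N)\times(0,\hat L)$, with $\hat L>0$, decomposed into $N$ overlapping subdomains $\Omega_j=(a_j,b_j)\times(0,\hat L)$, $j=1,\dots,N$, with $b_j-a_j=L+2\delta$, $b_{j-1}-a_j=2\delta$, $a_{j+1}-a_j=b_{j+1}-b_j=L$. The parallel Schwarz method computes iterates $u_j^n$ by solving $(ik\sigma-k^2)u_j^n-(\partial_{xx}+\partial_{yy})u_j^n=f$ in $\Omega_j$, with $\mathcal{B}_lu_j^n=\mathcal{B}_lu_{j-1}^{n-1}$ at $x=a_j$, $\mathcal{B}_ru_j^n=\mathcal{B}_ru_{j+1}^{n-1}$ at $x=b_j$ (with the prescribed boundary data at the two ends $x=a_1$, $x=b_N$), and $u_j^n=0$ for $y\in\{0,\hat L\}$, where $\mathcal{B}_l=-\partial_x+\alpha$, $\mathcal{B}_r=\partial_x+\alpha$. Expanding the local errors in a sine series in $y$ with Fourier numbers $\tilde k=\frac{m\pi}{\hat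 L}$, $m\in\{1,2,\dots\}$, each mode evolves independently, its Robin interface data being multiplied at each iteration by the matrix $\mathcal{T}_{1d}^{\mathrm H}(\tilde k)$. Here $\mathcal{T}_{1d}^{\mathrm H}(\tilde k)\in\mathbb{C}^{2(N-1)\times2(N-1)}$ is the block tridiagonal block Toeplitz matrix with $2\times2$ blocks: diagonal blocks $A_0=\begin{bmatrix}0&b\\ b&0\end{bmatrix}$, first superdiagonal blocks $A_1=\begin{bmatrix}a&0\\0&0\end{bmatrix}$, first subdiagonal blocks $A_{-1}=\begin{bmatrix}0&0\\0&a\end{bmatrix}$, where $$a=\frac{(\zeta+\alpha)^2e^{2\zeta\delta}-(\zeta-\alpha)^2e^{-2\zeta\delta}}{(\zeta+\alpha)^2e^{\zeta(2\delta+L)}-(\zeta-\alpha)^2e^{-\zeta(2\delta+L)}},\qquad b=-\frac{(\zeta^2-\alpha^2)(e^{\zeta L}-e^{-\zeta L})}{(\zeta+\alpha)^2e^{\zeta(2\delta+L)}-(\zeta-\alpha)^2e^{-\zeta(2\delta+L)}},$$ with $\alpha=ik$ and $\zeta=\zeta(\tilde k)=\sqrt{ik\sigma+\tilde k^2-k^2}$ (principal square root). With $\rho$ the spectral radius, $R_{1d}^{\mathrm H}(\tilde k):=\lim_{N\to\infty}\rho(\mathcal{T}_{1d}^{\mathrm H}(\tilde k))$ and $R_{2d}^{\mathrm H}:=\sup_{\tilde k}R_{1d}^{\mathrm H}(\tilde k)$, the supremum being over all $\tilde k=\frac{m\pi}{\hat L}$, $m\ge1$. *)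

(* Defs.v *)
From HB Require Import structures.
From mathcomp Require Import all_boot all_order all_algebra.
From mathcomp Require Import all_classical all_reals all_analysis.
From mathcomp Require Import complex.

Set Implicit Arguments.
Unset Strict Implicit.
Unset Printing Implicit Defensive.

Import Order.TTheory GRing.Theory Num.Theory.
Import numFieldNormedType.Exports.

Local Open Scope classical_set_scope.
Local Open Scope ring_scope.
Local Open Scope complex_scope.

Definition cexp (R : realType) (z : R[i]) : R[i] :=
  let: x +i* y := z in (expR x * cos y) +i* (expR x * sin y).

(* For the matrix of order 0 this is sup set0 = 0. *)
Definition spectral_radius (R : realType) (n : nat) (A : 'M[R[i]]_n) : R :=
  sup [set Normc.normc l | l in [set l : R[i] | eigenvalue A l]].

Definition mx2 (F : nzRingType) (x00 x01 x10 x11 : F) : 'M[F]_2 :=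
  \matrix_(i < 2, j < 2)
    if i == 0 then (if j == 0 then x00 else x01)
    else (if j == 0 then x10 else x11).

Definition block_tridiag_toeplitz (F : nzRingType) (n : nat)
    (Asub Adiag Asuper : 'M[F]_2) : 'M[F]_(\sum_(i < n) 2) :=
  \mxblock_(i < n, j < n)
    (if j == i :> nat then Adiag
     else if j == i.+1 :> nat then Asuper
     else if i == j.+1 :> nat then Asub
     else 0).

Section SchwarzIteration.
Variables (R : realType).
Implicit Types (alpha zeta : R[i]) (k sigma delta L ktilde Lhat : R) (N : nat).

Definition coef_den alpha zeta delta L : R[i] :=
  (zeta + alpha) ^+ 2 * cexp (zeta * (2 * delta + L)%:C)
  - (zeta - alpha) ^+ 2 * cexp (- (zeta * (2 * delta + L)%:C)).

Definition coef_a alpha zeta delta L : R[i] :=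
  ((zeta + alpha) ^+ 2 * cexp (2 * zeta * delta%:C)
   - (zeta - alpha) ^+ 2 * cexp (- (2 * zeta * delta%:C)))
  / coef_den alpha zeta delta L.

Definition coef_b alpha zeta delta L : R[i] :=
  - ((zeta ^+ 2 - alpha ^+ 2) * (cexp (zeta * L%:C) - cexp (- (zeta * L%:C)))
     / coef_den alpha zeta delta L).

(* complex.sqrtc is the principal square root. *)
Definition zeta_of k sigma ktilde : R[i] :=
  sqrtc ('i%C * (k * sigma)%:C + (ktilde ^+ 2)%:C - (k ^+ 2)%:C).

(* The order is the sum of N - 1 block sizes 2, that is 2 (N - 1). *)
Definition T1d alpha k sigma delta L ktilde N
    : 'M[R[i]]_(\sum_(i < N.-1) 2) :=
  let zeta := zeta_of k sigma ktilde in
  let a := coef_a alpha zeta delta L in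
  let b := coef_b alpha zeta delta L in
  block_tridiag_toeplitz N.-1 (mx2 0 0 0 a) (mx2 0 b b 0) (mx2 a 0 0 0).

Definition conv_factor alpha k sigma delta L ktilde : R^nat :=
  fun N => spectral_radius (T1d alpha k sigma delta L ktilde N).

(* lim is a total operator: this is the limit only when the sequence
   converges, which has to be asserted separately. *)
Definition R1d alpha k sigma delta L ktilde : R :=
  lim (conv_factor alpha k sigma delta L ktilde @ \oo).

Definition fourier_number Lhat (m : nat) : R := m%:R * pi / Lhat.

Definition R2d alpha k sigma delta L Lhat : \bar R :=
  ereal_sup [set (R1d alpha k sigma delta L (fourier_number Lhat m))%:E
            | m in [set m : nat | (0 < m)%N]].

(* The contraction factor is eventually bounded away from 1 uniformly in the
   number N of subdomains and in the Fourier mode. *)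
Definition schwarz_scales alpha k sigma delta L Lhat : Prop :=
  exists2 q : R, q < 1 &
    \forall N \near \oo, forall m : nat, (0 < m)%N ->
      conv_factor alpha k sigma delta L (fourier_number Lhat m) N <= q.

End SchwarzIteration.

(* Main.v *)
Require Import Defs.
From mathcomp Require Import all_boot all_order all_algebra.
From mathcomp Require Import all_classical all_reals all_analysis.
From mathcomp Require Import complex ring lra.

(** For [alpha = i k] write [w = exp (- zeta L)] and
    [g = (zeta - alpha) / (zeta + alpha) * exp (- 2 zeta delta)]. The theorem
    rests on two facts:
    - the limiting convergence factor of a mode is [max |a + b| |a - b|];
    - [a + b = (w - g) / (1 - g w)] and [a - b = (w + g) / (1 + g w)].

    _Limit of the spectral radius_. Once the unknowns are suitably paired, each
    pair is mapped to a single other pair, by the matrix [[b a; a b]], which is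
    normal with eigenvalues [b + a] and [b - a]; only the first and the last
    pair lose one output. So the Euclidean norm of the iteration matrix,
    hence its spectral radius, is at most [max |a + b| |a - b|] for every
    number of blocks. This uniform bound is also what makes the contraction
    factor independent of the number of subdomains once [R2d < 1].
    For the matching lower bound, the nonzero roots of the polynomials [D_n] of
    [schwarz_poly] are eigenvalues. At [s = a + b] the characteristic roots of
    the recurrence for [D_n] collide, so that [D_n s] and [D_n' s] are, up to a
    common geometric factor, polynomials in [n] of degree 1 and 3. Since
    [D_n' s / D_n s] is the sum of [1 / (s - r)] over the [2 n] roots [r], a
    quotient of size [n ^ 2] forces a root at distance [O(1 / n)] from [s]; the
    symmetry [b -> - b] gives [a - b]. The hypotheses [a != 0] and [b != 0]
    hold here because [zeta] has positive real and imaginary parts.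

    _Contraction_. With [|w| < 1] and [|g| < 1], both quotients above have
    modulus less than 1 if and only if
    [2 |Im w| / (1 - |w|^2) * 2 |Im g| / (1 - |g|^2) < 1]. Put
    [zeta = x + i y]; the first factor is [|sin (y L)| / sinh (x L)], which is
    less than [y / x] and less than [1 / (x L)]. For [delta = 0] the second
    factor is exactly [x / y], and it stays at most [x / y] for [delta > 0] as
    soon as [| |zeta|^2 - k^2 | * y^2 <= x^2 * (|zeta|^2 + k^2)]. This holds
    when [y <= x] (evanescent modes) and, for every mode, when
    [|zeta|^2 >= k^2], in particular when [sigma >= k]. For propagating modes
    and [sigma0 <= sigma < k] the numbers [x] and [y] stay in a compact subset
    of the open quadrant, so a large [L] makes the first factor small and a
    large [delta] the second one, while the other factor is at most [y / x].

    _Supremum over the modes_. For large Fourier numbers [w] and [g] tend to 0,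
    so all but finitely many modes have factor at most [1 / 2]. *)

Set Implicit Arguments.
Unset Strict Implicit.
Unset Printing Implicit Defensive.

Import Order.TTheory GRing.Theory Num.Theory.
Import numFieldNormedType.Exports.

Local Open Scope classical_set_scope.
Local Open Scope ring_scope.
Local Open Scope complex_scope.

(** * Roots of a polynomial with a large logarithmic derivative *)

(** The logarithmic derivative is the sum of the [1 / (z - r)]. Multiplying out
    keeps the bound true when [z] is itself a root. *)
Lemma deriv_prod_XsubC_bound (F : numClosedFieldType) (s : seq F) (z d : F) :
  0 <= d -> (forall r, r \in s -> d <= `|z - r|) ->
  let f := \prod_(r <- s) ('X - r%:P) in
  d * `|f^`().[z]| <= (size s)%:R * `|f.[z]|.
Proof.
move=> d0 /=; elim: s => [|r s IHs] sep.
  by rewrite big_nil derivC hornerC normr0 mulr0 mul0r.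
have {}IHs := IHs (fun u us => sep u (@mem_behead _ (r :: s) u us)).
rewrite big_cons; set f := \prod_(_ <- s) _ in IHs *.
rewrite derivM derivXsubC mul1r hornerD !hornerM hornerXsubC normrM.
apply: (@le_trans _ _ (d * (`|f.[z]| + `|z - r| * `|f^`().[z]|))).
  by rewrite ler_wpM2l// (le_trans (ler_normD _ _))// normrM.
rewrite mulrDr -[(size (r :: s))%:R]natr1 mulrDl addrC mul1r lerD//.
  by rewrite mulrCA (mulrCA _ `|z - r|) ler_wpM2l.
by rewrite ler_wpM2r// sep// mem_head.
Qed.

Lemma root_near (F : numClosedFieldType) (p : {poly F}) (z d : F) :
  0 < d -> (size p).-1%:R * `|p.[z]| < d * `|p^`().[z]| ->
  exists2 r, root p r & `|z - r| < d.
Proof.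
move=> d0 lt_d.
have p0 : p != 0.
  by apply: contraTneq lt_d => ->; rewrite derivC hornerC normr0 !mulr0 ltxx.
have [s ps] := closed_field_poly_normal p.
have lp0 : lead_coef p != 0 by rewrite lead_coef_eq0.
have [/hasP[r rs ltr]|/hasPn far] := boolP (has (fun r => `|z - r| < d) s).
  by exists r; rewrite // ps rootZ// root_prod_XsubC.
suff: d * `|p^`().[z]| <= (size p).-1%:R * `|p.[z]|.
  by rewrite (lt_geF lt_d).
have -> : (size p).-1 = size s.
  by rewrite ps size_scale// size_prod_XsubC.
rewrite ps derivZ !hornerZ !normrM mulrCA (mulrCA _ `|lead_coef p|) ler_wpM2l//.
apply: deriv_prod_XsubC_bound; first exact: ltW.
move=> r rs; have := far _ rs.
by rewrite -real_leNgt// ?gtr0_real// normr_real.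
Qed.

(** * Eigenvectors of the iteration matrix *)

Section Toeplitz.
Variable F : fieldType.
Implicit Types (a b l : F) (n : nat).

Definition schwarz_mx n a b : 'M[F]_(\sum_(i < n) 2) :=
  block_tridiag_toeplitz n (mx2 0 0 0 a) (mx2 0 b b 0) (mx2 a 0 0 0).

(** Eigenvalues are defined through row vectors, hence the transposed coupling.
    The first components are shifted by one, [p j.+1] being that of block [j],
    so that both boundary conditions become the vanishing of one term. *)
Definition left_eigenseq n a b l (p q : nat -> F) : Prop :=
  [/\ p 0%N = 0, q n = 0 &
   forall j, (j < n)%N ->
     l * p j.+1 = b * q j + a * p j /\ l * q j = b * p j.+1 + a * q j.+1].

Definition row2 (x y : F) : 'rV[F]_2 := \row_j (if j == 0 then x else y).

Lemma row2K (v : 'rV[F]_2) : row2 (v 0 0) (v 0 1) = v.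
Proof.
apply/rowP => j; rewrite mxE.
by case: j => -[|[|//]] jlt /=; congr (v _ _); apply: val_inj.
Qed.

Lemma row2_mul x y c00 c01 c10 c11 :
  row2 x y *m mx2 c00 c01 c10 c11 =
  row2 (x * c00 + y * c10) (x * c01 + y * c11).
Proof.
by apply/rowP => j; rewrite !mxE !big_ord_recr big_ord0 /= add0r !mxE; case: ifP.
Qed.

Lemma row2_sum (I : finType) (x y : I -> F) :
  \sum_i row2 (x i) (y i) = row2 (\sum_i x i) (\sum_i y i).
Proof.
apply/rowP => j; rewrite summxE mxE.
by case: ifP => j0; apply: eq_bigr => i _; rewrite mxE j0.
Qed.

Lemma mul_schwarz_mx n a b (p q : nat -> F) : p 0%N = 0 -> q n = 0 ->
  (\mxrow_(i < n) row2 (p i.+1) (q i)) *m schwarz_mx n a b =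
  \mxrow_(i < n) row2 (b * q i + a * p i) (b * p i.+1 + a * q i.+1).
Proof.
move=> p0 qn; rewrite mul_mxrow_mxblock; apply: eq_mxrow => j.
pose x (i : 'I_n) := (if j == i :> nat then b * q i else 0)
                   + (if j == i.+1 :> nat then a * p i.+1 else 0).
pose y (i : 'I_n) := (if j == i :> nat then b * p i.+1 else 0)
                   + (if i == j.+1 :> nat then a * q i else 0).
have -> : \sum_(i < n) row2 (p i.+1) (q i) *m
    (if j == i :> nat then mx2 0 b b 0 else if j == i.+1 :> nat
     then mx2 a 0 0 0 else if i == j.+1 :> nat then mx2 0 0 0 a else 0)
  = \sum_i row2 (x i) (y i).
  apply: eq_bigr => i _; rewrite /x /y.
  have [->|ji] := eqVneq (j : nat) i.
    by rewrite row2_mul !mulr0 (ltn_eqF (leqnn _)) !addr0 add0r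
      (mulrC (q i)) (mulrC (p _)).
  have [ji1|ji1] := eqVneq (j : nat) i.+1.
    have /negPf -> : (i : nat) != j.+1 by rewrite ji1 -addn2 -{1}[i : nat]addn0 eqn_add2l.
    by rewrite row2_mul !mulr0 !addr0 add0r (mulrC (p _)).
  have [ij|ij] := eqVneq (i : nat) j.+1.
    by rewrite row2_mul !mulr0 !addr0 !add0r (mulrC (q _)).
  by rewrite mulmx0 !addr0; apply/rowP => c; rewrite !mxE if_same.
rewrite row2_sum; congr row2.
  rewrite big_split /=; congr (_ + _).
    by rewrite -big_mkcond (big_pred1 j)// => i; rewrite eq_sym.
  rewrite -big_mkcond /=; case: j {x y} => -[|j] jn /=.
    by rewrite big_pred0 ?p0 ?mulr0// => i.
  by rewrite (big_pred1 (Ordinal (ltnW jn)))// => i; rewrite eqSS eq_sym.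
rewrite big_split /=; congr (_ + _).
  by rewrite -big_mkcond (big_pred1 j)// => i; rewrite eq_sym.
rewrite -big_mkcond /=; have [jn|] := ltnP j.+1 n.
  by rewrite (big_pred1 (Ordinal jn)).
move=> nj; have -> : j.+1 = n by apply/eqP; rewrite eqn_leq nj andbT.
by rewrite big_pred0 ?qn ?mulr0// => i; rewrite ltn_eqF.
Qed.

Lemma eigenvalue_schwarz_mxP n a b l :
  eigenvalue (schwarz_mx n a b) l <->
  exists p q, left_eigenseq n a b l p q /\
    exists2 j, (j < n)%N & p j.+1 != 0 \/ q j != 0.
Proof.
split.
  case/eigenvalueP => v vT v0.
  pose V (i : 'I_n) : 'rV_2 := @submxrow _ n (fun=> 2%N) 1 v i.
  pose p j := if j is i.+1 then if insub i is Some k then V k 0 0 else 0 else 0.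
  pose q j := if insub j is Some k then V k 0 1 else 0.
  have vE : v = \mxrow_(i < n) row2 (p i.+1) (q i).
    rewrite -[LHS]submxrowK; apply: eq_mxrow => i.
    by rewrite /p /q !valK row2K.
  have p0 : p 0%N = 0 by [].
  have qn : q n = 0 by rewrite /q insubF// ltnn.
  exists p, q; split.
    split=> // j jn; move: vT; rewrite vE mul_schwarz_mx// -mul_scalar_mx mul_mxrow.
    move/eq_mxrowP => /(_ (Ordinal jn)) /=; rewrite mul_scalar_mx.
    move=> /rowP e; have := e 0; have := e 1; rewrite !mxE /= => e1 e0.
    by rewrite -e0 -e1.
  apply: contrapT => allz.
  have pq0 (i : 'I_n) : p i.+1 = 0 /\ q i = 0.
    by split; apply/eqP/negPn/negP => nz; apply: allz; exists i => //; [left|right].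
  move/eqP: v0; apply; rewrite vE -[RHS](@mxrow0 _ n (fun=> 2%N)).
  apply: eq_mxrow => i; have [-> ->] := pq0 i.
  by apply/rowP => c; rewrite !mxE if_same.
case=> p [q [[p0 qn e] [j jn nz]]]; apply/eigenvalueP.
exists (\mxrow_(i < n) row2 (p i.+1) (q i)).
  rewrite mul_schwarz_mx// -mul_scalar_mx mul_mxrow; apply: eq_mxrow => i.
  rewrite mul_scalar_mx; have [<- <-] := e i (ltn_ord i).
  by apply/rowP => c; rewrite !mxE; case: ifP.
apply/eqP; rewrite -(@mxrow0 _ n (fun=> 2%N)) => /eq_mxrowP /(_ (Ordinal jn)) /rowP h.
have := h 0; have := h 1; rewrite !mxE /= => q0 pj0.
by case: nz; rewrite ?q0 ?pj0 eqxx.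
Qed.

End Toeplitz.

Local Notation nc := (@Normc.normc _).
Local Notation Re := complex.Re.
Local Notation Im := complex.Im.

(** * The spectral radius in the limit of many subdomains *)

Section Modulus.
Variable R : realType.
Local Notation C := R[i].
Implicit Types z w : C.

Definition sqmod z : R := Re z ^+ 2 + Im z ^+ 2.

Lemma sqmod_ge0 z : 0 <= sqmod z.
Proof. by rewrite addr_ge0 ?sqr_ge0. Qed.

Lemma normcD_le z w : nc (z + w) <= nc z + nc w.
Proof. exact: le_normcD. Qed.

Lemma normc_ge0 z : 0 <= nc z.
Proof. by case: z => x y; rewrite sqrtr_ge0. Qed.

Lemma normc_sqr z : nc z ^+ 2 = sqmod z.
Proof. by case: z => x y; rewrite sqr_sqrtr// (sqmod_ge0 (x +i* y)). Qed.

Lemma normC_normc z : `|z| = (nc z)%:C.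
Proof. by []. Qed.

Lemma sqmodM z w : sqmod (z * w) = sqmod z * sqmod w.
Proof. by case: z w => [x y] [u v]; rewrite /sqmod /=; ring. Qed.

Lemma sqmod_eq0 z : (sqmod z == 0) = (z == 0).
Proof.
case: z => x y; rewrite /sqmod /= paddr_eq0 ?sqr_ge0// !sqrf_eq0.
by rewrite eq_complex.
Qed.

Lemma parallelogram_swap (a b z w : C) :
  2 * (sqmod (b * z + a * w) + sqmod (b * w + a * z)) =
  sqmod (a + b) * sqmod (z + w) + sqmod (a - b) * sqmod (z - w).
Proof.
by case: a b z w => [a a'] [b b'] [z z'] [w w']; rewrite /sqmod /=; ring.
Qed.

Lemma sqmod_parallelogram z w :
  sqmod (z + w) + sqmod (z - w) = 2 * (sqmod z + sqmod w).
Proof. by case: z w => [x y] [u v]; rewrite /sqmod /=; ring. Qed.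

(** The matrix [[b a; a b]] is normal with eigenvalues [b + a] and [b - a]. *)
Lemma sqmod_swap_le (a b z w : C) :
  sqmod (b * z + a * w) + sqmod (b * w + a * z) <=
  Num.max (sqmod (a + b)) (sqmod (a - b)) * (sqmod z + sqmod w).
Proof.
rewrite -(ler_pM2l (ltr0n R 2)) parallelogram_swap mulrCA -sqmod_parallelogram
  [leRHS]mulrDr.
by apply: lerD; rewrite ler_wpM2r ?sqmod_ge0// le_max lexx ?orbT.
Qed.

End Modulus.

Section SpectralRadius.
Variable R : realType.
Local Notation C := R[i].
Implicit Types (a b l s : C) (n : nat).

(** The eigenvalues [a cos t +- sqrt (b^2 - a^2 sin^2 t)] of the symbol of the
    Toeplitz matrix have their largest modulus at [t = 0] or [t = pi]. *)
Definition mode_radius a b : R := Num.max (nc (a + b)) (nc (a - b)).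

(** Each pair [(q j, p j)] is only mapped to the pair made of [l * p j.+1] and
    of [l * q j.-1], by the normal matrix of [sqmod_swap_le]; the first and the
    last pair lose one output. So the matrix has operator norm at most
    [mode_radius a b], whatever its size. *)
Lemma left_eigenseq_le n a b l p q :
  left_eigenseq n a b l p q ->
  (exists2 j, (j < n)%N & p j.+1 != 0 \/ q j != 0) ->
  nc l <= mode_radius a b.
Proof.
case=> p0 qn e nz.
pose M := Num.max (sqmod (a + b)) (sqmod (a - b)).
pose S := \sum_(0 <= j < n) (sqmod (p j.+1) + sqmod (q j)).
have S0 : 0 < S.
  case: nz => j jn nz; rewrite /S (@big_cat_nat _ _ _ j.+1)//= big_nat_recr//=.
  rewrite ltr_pwDl//; last by apply: sumr_ge0 => i _; rewrite addr_ge0 ?sqmod_ge0.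
  rewrite ltr_wpDl//; first by apply: sumr_ge0 => i _; rewrite addr_ge0 ?sqmod_ge0.
  case: nz => nz; [rewrite ltr_pwDl ?sqmod_ge0//|rewrite ltr_wpDl ?sqmod_ge0//];
    by rewrite lt0r sqmod_eq0 nz sqmod_ge0.
have lS : sqmod l * S <= M * S.
  have -> : sqmod l * S = \sum_(0 <= j < n) sqmod (b * q j + a * p j) +
                          \sum_(0 <= j < n) sqmod (b * p j.+1 + a * q j.+1).
    rewrite -big_split /S big_distrr /= !big_nat; apply: eq_bigr => j /andP[_ jn].
    by have [<- <-] := e _ jn; rewrite !sqmodM -mulrDr.
  apply: (@le_trans _ _ (\sum_(0 <= j < n.+1)
      (sqmod (b * q j + a * p j) + sqmod (b * p j + a * q j)))).
    rewrite [leRHS]big_split /=; apply: lerD.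
      by rewrite big_nat_recr//= lerDl sqmod_ge0.
    by rewrite [leRHS]big_nat_recl//= lerDr sqmod_ge0.
  apply: (@le_trans _ _ (\sum_(0 <= j < n.+1) (M * (sqmod (q j) + sqmod (p j))))).
    by apply: ler_sum => j _; exact: sqmod_swap_le.
  have z0 : sqmod (0 : C) = 0 by apply/eqP; rewrite sqmod_eq0.
  rewrite -big_distrr /= big_split /= big_nat_recr//= qn z0 addr0.
  by rewrite [X in _ + X]big_nat_recl//= p0 z0 add0r -big_split /S/=;
    under eq_bigr do rewrite addrC.
move: lS; rewrite ler_pM2r// /M -!normc_sqr /mode_radius !le_max.
by rewrite !ler_sqr ?nnegrE ?normc_ge0.
Qed.

Lemma eigenvalue_schwarz_mx_le n a b l :
  eigenvalue (schwarz_mx n a b) l -> nc l <= mode_radius a b.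
Proof. by case/eigenvalue_schwarz_mxP => p [q [/left_eigenseq_le]]. Qed.

Lemma mode_radius_ge0 a b : 0 <= mode_radius a b.
Proof. by rewrite le_max normc_ge0. Qed.

Lemma spectral_radius_schwarz_mx_le n a b :
  spectral_radius (schwarz_mx n a b) <= mode_radius a b.
Proof.
rewrite /spectral_radius; set S := [set _ | _ in _].
have [->|/set0P S0] := eqVneq S set0; first by rewrite sup0 mode_radius_ge0.
by apply: ge_sup => // _ [l /= /eigenvalue_schwarz_mx_le ? <-].
Qed.

Lemma spectral_radius_schwarz_mx_ge n a b l :
  eigenvalue (schwarz_mx n a b) l -> nc l <= spectral_radius (schwarz_mx n a b).
Proof.
move=> lT; apply: ub_le_sup; last by exists l.
by exists (mode_radius a b) => _ [u /= /eigenvalue_schwarz_mx_le ? <-].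
Qed.

(** Up to a factor [(a l)^n], the value at [l] is the component [q n] which the
    eigenvector recurrences produce from [p 0 = 0] and [q 0 = 1]. Its nonzero
    roots are thus the [l] for which the remaining condition [q n = 0] holds. *)
Fixpoint schwarz_poly a b n : {poly C} :=
  if n is n1.+1 then
    if n1 is n2.+1 then
      ('X^2 + (a ^+ 2 - b ^+ 2)%:P) * schwarz_poly a b n1
      - (a ^+ 2)%:P * 'X^2 * schwarz_poly a b n2
    else 'X^2 - (b ^+ 2)%:P
  else 1.

Lemma schwarz_polySS a b n : schwarz_poly a b n.+2 =
  ('X^2 + (a ^+ 2 - b ^+ 2)%:P) * schwarz_poly a b n.+1
  - (a ^+ 2)%:P * 'X^2 * schwarz_poly a b n.
Proof. by []. Qed.

Lemma nat_ind2 (P : nat -> Prop) : P 0%N -> P 1%N ->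
  (forall n, P n -> P n.+1 -> P n.+2) -> forall n, P n.
Proof.
move=> P0 P1 PSS n; suff: P n /\ P n.+1 by case.
by elim: n => [//|n [? ?]]; split=> //; exact: PSS.
Qed.

Lemma size_schwarz_poly a b n : (size (schwarz_poly a b n) <= n.*2.+1)%N.
Proof.
elim/nat_ind2: n => [||n IH0 IH1].
- by rewrite size_poly1.
- by rewrite /= size_XnsubC.
rewrite schwarz_polySS; apply: leq_trans (size_polyD _ _) _.
rewrite size_polyN geq_max; apply/andP; split.
  apply: leq_trans (size_polyMleq _ _) _; by rewrite size_XnaddC.
rewrite -mulrA mul_polyC; apply: leq_trans (size_scale_leq _ _) _.
apply: leq_trans (size_polyMleq _ _) _; rewrite size_polyXn /=.
by rewrite !doubleS; do 2!apply: leqW; exact: IH0.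
Qed.

Lemma eigenvalue_schwarz_poly a b l n : a != 0 -> b != 0 -> l != 0 -> (0 < n)%N ->
  root (schwarz_poly a b n) l -> eigenvalue (schwarz_mx n a b) l.
Proof.
move=> a0 b0 l0 n0 /rootP Dn; apply/eigenvalue_schwarz_mxP.
pose q j := (schwarz_poly a b j).[l] / (a * l) ^+ j.
pose p j := if j is i.+1 then (l * q i - a * q i.+1) / b else 0.
exists p, q; split; last first.
  by exists 0%N => //; right; rewrite /q hornerC expr0 divr1 oner_eq0.
split=> [//||j jn]; first by rewrite /q Dn mul0r.
have al : a * l != 0 by rewrite mulf_neq0.
split; last by rewrite /p /= [b * _]mulrC divfK// subrK.
case: j {jn} => [|j] /=; rewrite /q.
  rewrite /= !(hornerM, hornerD, hornerN, hornerXn, hornerX, hornerC).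
  by field; rewrite a0 b0 l0.
rewrite schwarz_polySS !(hornerM, hornerD, hornerN, hornerXn, hornerX, hornerC).
rewrite !exprS; set x := _ ^+ j.
have x0 : x != 0 by rewrite expf_neq0.
by field; rewrite a0 b0 l0 x0.
Qed.

(** At [a + b] the equation [t^2 - (s^2 + a^2 - b^2) t + a^2 s^2 = 0] of the
    recurrence has the double root [a s]. *)
Lemma horner_schwarz_poly a b n : a != 0 -> a + b != 0 ->
  (schwarz_poly a b n).[a + b] = (a * (a + b)) ^+ n * (1 + n%:R * b / (a + b)).
Proof.
move=> a0 s0; elim/nat_ind2: n => [||n IH0 IH1].
- by rewrite /= hornerC expr0 !mul0r addr0 mulr1.
- by rewrite /= !(hornerM, hornerD, hornerN, hornerXn, hornerX, hornerC); field.
rewrite schwarz_polySS !(hornerM, hornerD, hornerN, hornerXn, hornerX, hornerC).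
rewrite IH0 IH1 !exprS -!natr1; set x := _ ^+ n.
by field.
Qed.

(** The differentiated recurrence has the same double root and a right-hand side
    that is affine in [n], which makes the solution cubic in [n]. *)
Lemma deriv_schwarz_poly a b n : a != 0 -> a + b != 0 ->
  let s := a + b in let m : C := n%:R in
  (schwarz_poly a b n)^`().[s] = (a * s) ^+ n *
   (m * (2 / a + (m - 1) * (2 * b / (a * s) + (m - 2) * (b ^+ 2 / (3 * a * s ^+ 2))))).
Proof.
move=> a0 s0 /=; elim/nat_ind2: n => [||n IH0 IH1].
- by rewrite /= derivC hornerC !mul0r mulr0.
- rewrite /= derivB derivXn derivC !(hornerM, hornerD, hornerN, hornerXn, hornerX, hornerC).
  by field; rewrite a0 s0.
rewrite schwarz_polySS !(derivXn, derivC, derivB, derivD, derivM).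
rewrite !(hornerM, hornerD, hornerN, hornerXn, hornerX, hornerC) IH0 IH1.
rewrite !horner_schwarz_poly//.
rewrite !(exprS (a * (a + b))) -(natr1 n.+1) -(natr1 n); set x := _ ^+ n.
by field; rewrite a0 s0.
Qed.

Lemma cubic_beats_quadratic (A B K d : R) : 0 < d -> 0 < K ->
  \forall n \near \oo,
    (n.*2)%:R * (1 + n%:R * A) <
    d * (K * (n%:R * (n%:R - 1) * (n%:R - 2)) - B * n%:R ^+ 2).
Proof.
move=> d0 K0.
have dK : 0 < d * K by exact: mulr_gt0.
near=> n.
have n4 : 4 <= n%:R :> R by rewrite ler_nat; near: n; exists 4%N.
have nbig : (2 * (1 + `|A|) + d * `|B|) / (d * K / 4) < n%:R :> R.
  by near: n; exact: nbhs_infty_gtr.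
rewrite ltr_pdivrMr ?divr_gt0// in nbig.
set x := n%:R in n4 nbig *.
have -> : (n.*2)%:R = 2 * x by rewrite -mul2n natrM.
have := ler_norm A; have := ler_norm B; have := normr_ge0 B; have := normr_ge0 A.
move: `|A| `|B| nbig => A' B' nbig A0 B0 leB leA.
have x0 : 0 < x by lra.
have H1 : 2 * x * (1 + x * A) <= x ^+ 2 * (2 * (1 + A')).
  have : x * A <= x * A' by rewrite ler_pM2l.
  nra.
have H2 : d * (B * x ^+ 2) <= x ^+ 2 * (d * B').
  have : B * (d * x ^+ 2) <= B' * (d * x ^+ 2)
    by rewrite ler_wpM2r// mulr_ge0 ?sqr_ge0 ?ltW.
  lra.
have H3 : x ^+ 2 * (x * (d * K / 4)) <= d * (K * (x * (x - 1) * (x - 2))).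
  (* (x - 1) (x - 2) >= x^2 / 4 as soon as x >= 4. *)
  have : x ^+ 3 / 4 <= x * (x - 1) * (x - 2).
    suff : 0 <= x * (3 * (x - 4) * x + 8) by lra.
    have : 0 <= (x - 4) * x by rewrite mulr_ge0//; lra.
    by move=> ?; rewrite mulr_ge0//; lra.
  rewrite -(ler_pM2l dK); lra.
have H4 : x ^+ 2 * (2 * (1 + A') + d * B') < x ^+ 2 * (x * (d * K / 4)).
  by rewrite ltr_pM2l ?exprn_gt0.
lra.
Unshelve. all: by end_near. Qed.

(** The ratio of the derivative to the value grows like [n^2], and the degree
    only like [2 n]. *)
Lemma schwarz_poly_root_near a b (d : R) : a != 0 -> b != 0 -> a + b != 0 -> 0 < d ->
  \forall n \near \oo, exists2 l, root (schwarz_poly a b n) l & nc (a + b - l) < d.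
Proof.
move=> a0 b0 s0 d0.
pose s := a + b.
pose e := 2 / a; pose f := 2 * b / (a * s); pose k := b ^+ 2 / (3 * a * s ^+ 2).
pose K := nc k.
have K0 : 0 < K.
  rewrite lt0r normc_ge0 andbT; apply/eqP => /Normc.eq0_normc/eqP.
  by rewrite !mulf_eq0 invr_eq0 !mulf_eq0 ?expf_eq0 /=
    (negPf a0) (negPf b0) (negPf s0) pnatr_eq0.
near=> n.
have n2 : (2 <= n)%N by near: n; exists 2%N.
have lt_d : (n.*2)%:R * (1 + n%:R * nc (b / s)) <
    d * (K * (n%:R * (n%:R - 1) * (n%:R - 2))
         - (nc e + nc f) * n%:R ^+ 2).
  by near: n; exact: cubic_beats_quadratic.
have nc_nat (i : nat) : nc (i%:R : C) = i%:R.
  by rewrite -(rmorph_nat (real_complex R)) /= expr0n addr0 sqrtr_sqr ger0_norm.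
have nc_sub (i : nat) : (i <= n)%N -> nc ((n%:R : C) - i%:R) = n%:R - i%:R.
  by move=> kn; rewrite -!natrB.
have [] := @root_near R[i] (schwarz_poly a b n) s d%:C; first by rewrite ltcR.
  rewrite horner_schwarz_poly// deriv_schwarz_poly// -/s !normrM mulrCA (mulrCA d%:C).
  rewrite ltr_pM2l ?normr_gt0 ?expf_neq0 ?mulf_neq0//.
  rewrite -normrM !normC_normc -(rmorph_nat (real_complex R)) -!rmorphM ltcR.
  apply: le_lt_trans (lt_le_trans lt_d _).
    rewrite ler_pM ?normc_ge0// ?ler_nat.
      by have := size_schwarz_poly a b n; rewrite -ltnS; case: (size _).
    apply: le_trans (normcD_le _ _) _; rewrite -mulrA Normc.normcM nc_nat.
    by rewrite (nc_nat 1%N).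
  rewrite ler_wpM2l ?(ltW d0)// -/e -/f -/k.
  (* Isolate the cubic term of the derivative; the others are absorbed by n^2. *)
  have e1 : K * (n%:R * (n%:R - 1) * (n%:R - 2)) =
      nc (n%:R * (e + (n%:R - 1) * (f + (n%:R - 2) * k))
          + (- (n%:R * e) + - (n%:R * (n%:R - 1) * f))).
    rewrite -[n%:R * (n%:R - 1) * _ in LHS](_ : nc (n%:R * (n%:R - 1) * (n%:R - 2)) = _).
      by rewrite mulrC -Normc.normcM; congr nc; ring.
    by rewrite !Normc.normcM nc_nat (nc_sub 1%N (ltnW n2)) (nc_sub 2 n2).
  rewrite e1 lerBlDr; apply: le_trans (normcD_le _ _) _; rewrite lerD2l.
  apply: le_trans (normcD_le _ _) _; rewrite !normcN.
  rewrite (Normc.normcM _ e) (Normc.normcM _ f) (Normc.normcM n%:R (n%:R - 1)).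
  rewrite nc_nat (nc_sub 1%N (ltnW n2)).
  have n1 : 1 <= n%:R :> R by rewrite ler1n ltnW.
  have := normc_ge0 e; have := normc_ge0 f.
  move: (nc e) (nc f) (n%:R : R) n1 => e' f' x n1 f0 e0.
  rewrite [leRHS]mulrDl; apply: lerD; first by rewrite mulrC ler_wpM2l//; nra.
  by rewrite mulrC ler_wpM2l//; nra.
move=> l Dl; rewrite normC_normc ltcR => ls; exists l => //.
Unshelve. all: by end_near. Qed.

Lemma eq_schwarz_poly a b c n : c ^+ 2 = b ^+ 2 ->
  schwarz_poly a c n = schwarz_poly a b n.
Proof.
move=> cb; elim/nat_ind2: n => [//||n IH0 IH1]; first by rewrite /= cb.
by rewrite !schwarz_polySS cb IH0 IH1.
Qed.

(** Only [b^2] enters [schwarz_poly], so [c] stands for [b] or [- b] and one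
    statement covers the limit points [a + b] and [a - b]. *)
Lemma spectral_radius_schwarz_mx_lower_near a b c (d : R) :
  a != 0 -> b != 0 -> c ^+ 2 = b ^+ 2 -> a + c != 0 -> 0 < d ->
  \forall n \near \oo, nc (a + c) - d <= spectral_radius (schwarz_mx n a b).
Proof.
move=> a0 b0 cb s0 d0.
have c0 : c != 0 by rewrite -sqrf_eq0 cb sqrf_eq0.
have ns0 : 0 < nc (a + c).
  by rewrite lt0r normc_ge0 andbT; apply: contra s0 => /eqP/Normc.eq0_normc ->.
(* A root at distance less than |a + c| from a + c is nonzero, as the
   eigenvector requires. *)
pose e := Num.min d (nc (a + c)).
have e0 : 0 < e by rewrite lt_min d0 ns0.
near=> n.
have [l Dl lt_e] : exists2 l, root (schwarz_poly a b n) l & nc (a + c - l) < e.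
  near: n; apply: filterS (schwarz_poly_root_near a0 c0 s0 e0) => n [l].
  by rewrite (eq_schwarz_poly _ _ cb) => Dl le; exists l.
have l0 : l != 0.
  by apply: contraTneq lt_e => ->; rewrite subr0 -leNgt ge_min lexx orbT.
have n0 : (0 < n)%N by near: n; exists 1%N.
have := spectral_radius_schwarz_mx_ge (eigenvalue_schwarz_poly a0 b0 l0 n0 Dl).
apply: le_trans; rewrite lerBlDr.
have {1}-> : a + c = l + (a + c - l) by ring.
apply: le_trans (normcD_le _ _) _; rewrite lerD2l (le_trans (ltW lt_e))//.
by rewrite ge_min lexx.
Unshelve. all: by end_near. Qed.

Lemma mode_radius_gt0 a b : a != 0 -> 0 < mode_radius a b.
Proof.
move=> a0; rewrite lt0r mode_radius_ge0 andbT; apply: contra a0 => /eqP m0.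
have nc0 z : nc z <= mode_radius a b -> z = 0.
  by rewrite m0 => z0; apply: Normc.eq0_normc; apply/eqP; rewrite eq_le z0 normc_ge0.
have s0 : a + b = 0 by apply: nc0; rewrite le_max lexx.
have d0 : a - b = 0 by apply: nc0; rewrite le_max lexx orbT.
have : a *+ 2 = 0 by rewrite -[RHS]addr0 -{1}s0 -d0; ring.
by move/eqP; rewrite mulrn_eq0.
Qed.

Lemma mode_radius_lower_near a b (d : R) : a != 0 -> b != 0 -> 0 < d ->
  \forall n \near \oo, mode_radius a b - d <= spectral_radius (schwarz_mx n a b).
Proof.
move=> a0 b0 d0.
have [c cb mc] : exists2 c, c ^+ 2 = b ^+ 2 & mode_radius a b = nc (a + c).
  rewrite /mode_radius; case: leP => _; [exists (- b)|exists b] => //.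
  by rewrite sqrrN.
rewrite mc; apply: spectral_radius_schwarz_mx_lower_near => //.
by apply: contraTneq (mode_radius_gt0 b a0); rewrite mc => ->; rewrite Normc.normc0 ltxx.
Qed.

Lemma cvg_spectral_radius_schwarz_mx a b : a != 0 -> b != 0 ->
  spectral_radius (schwarz_mx n a b) @[n --> \oo] --> mode_radius a b.
Proof.
move=> a0 b0; apply/cvgrPdist_le => e e0; near=> n.
rewrite ger0_norm ?subr_ge0 ?spectral_radius_schwarz_mx_le// lerBlDr -lerBlDl.
by near: n; exact: mode_radius_lower_near.
Unshelve. all: by end_near. Qed.

End SpectralRadius.

(** * Decaying exponentials and a contraction criterion *)

Section Elementary.
Variable R : realType.
Implicit Types x t : R.

Lemma ltr_2x_expR_sub x : 0 < x -> 2 * x < expR x - expR (- x).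
Proof.
move=> x0.
pose f u : R := expR u - expR (- u).
have df u : is_derive u (1 : R) f (expR u + expR (- u)).
  by apply: is_derive_eq; rewrite mulrN1 opprK.
have [|c] := MVT x0 (fun u _ => df u).
  apply: continuous_subspaceT => u; apply: differentiable_continuous.
  by apply/derivable1_diffP; have [] := df u.
rewrite in_itv /= => /andP[c0 _].
move=> fE; have -> : expR x - expR (- x) = (expR c + expR (- c)) * x.
  by move: fE; rewrite /f subr0 oppr0 subrr subr0.
rewrite ltr_pM2r//.
have c1 : 1 < expR c by rewrite expR_gt1.
have E : expR c * expR (- c) = 1 by rewrite -expRD subrr expR0.
have e0 := expR_gt0 (- c).
nra.
Qed.

Lemma normr_sin_le t : `|sin t| <= `|t|.
Proof.
wlog t0 : t / 0 < t.
  move=> W; case: (ltrgtP t 0) => [t0|/W//|->]; last by rewrite sin0.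
  by rewrite -normrN -sinN -(normrN t) W ?oppr_gt0.
have [|c _] := MVT t0 (fun u _ => is_derive_sin u).
  by apply: continuous_subspaceT => u; exact: continuous_sin.
rewrite sin0 !subr0 => ->; rewrite normrM ler_piMl// ler_norml cos_le1 cos_geN1//.
Qed.

End Elementary.

Section ContractionCriterion.
Variable R : realType.
Local Notation C := R[i].
Implicit Types (z w g e : C).

Lemma normc_lt1 z : (nc z < 1) = (sqmod z < 1).
Proof. by rewrite -normc_sqr expr_lt1 ?normc_ge0. Qed.

(** The identity [|1 - g w|^2 - |w - g|^2 = (1 - |w|^2) (1 - |g|^2) + 4 Im w Im g]
    differs from the one for the Blaschke factor by its last term, because [g]
    is not conjugated in the denominator. *)
Lemma blaschke_lt1 w g :
  sqmod w < 1 -> sqmod g < 1 ->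
  4 * `|Im w| * `|Im g| < (1 - sqmod w) * (1 - sqmod g) ->
  nc ((w - g) / (1 - g * w)) < 1.
Proof.
move=> w1 g1 lt; rewrite normc_lt1.
have e : sqmod (1 - g * w) - sqmod (w - g) =
    (1 - sqmod w) * (1 - sqmod g) + 4 * (Im w * Im g).
  by move: w g {w1 g1 lt} => [? ?] [? ?]; rewrite /sqmod /=; ring.
have le : - (4 * (Im w * Im g)) <= 4 * `|Im w| * `|Im g|.
  by rewrite -mulrA -normrM -mulrN ler_pM2l// -normrN ler_norm.
have lt' : sqmod (w - g) < sqmod (1 - g * w) by rewrite -subr_gt0 e; lra.
have d0 : 0 < sqmod (1 - g * w) by exact: le_lt_trans (sqmod_ge0 _) lt'.
rewrite -!normc_sqr Normc.normcM Normc.normcV exprMn exprVn !normc_sqr.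
by rewrite ltr_pdivrMr// mul1r.
Qed.

(** If [|g| = exp (- X)] then [2 |Im g| / (1 - |g|^2)] is [|sin (arg g)| / sinh X],
    and this lemma is the comparison of the addition formulas of [sin] and
    [sinh]. The second hypothesis couples [g] and [e]: a bound on [Re g] better
    than [(1 + |g|^2) / 2] compensates a weak bound on [Im e]. *)
Lemma Im_prod_le g e (M : R) :
  2 * `|Im g| <= M * (1 - sqmod g) ->
  2 * `|Re g| * `|Im e| <= M * ((1 + sqmod g) / 2 * (1 - sqmod e)) ->
  2 * `|Im (g * e)| <= M * (1 - sqmod (g * e)).
Proof.
move=> Hg He.
have E : Im (g * e) = Re g * Im e + Im g * Re e by case: g e {Hg He} => [? ?] [? ?].
have re : `|Re e| <= (1 + sqmod e) / 2.
  have : `|Re e| ^+ 2 <= sqmod e by rewrite /sqmod real_normK ?num_real// lerDl sqr_ge0.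
  have := sqr_ge0 (`|Re e| - 1); lra.
have tri : 2 * `|Im (g * e)| <= 2 * `|Re g| * `|Im e| + 2 * `|Im g| * `|Re e|.
  by rewrite E -!mulrA -mulrDr ler_pM2l// -!normrM ler_normD.
have H1 : 2 * `|Im g| * `|Re e| <= M * (1 - sqmod g) * ((1 + sqmod e) / 2).
  by apply: ler_pM.
rewrite sqmodM; apply: le_trans tri _; lra.
Qed.

End ContractionCriterion.

Section Cexp.
Variable R : realType.
Local Notation C := R[i].
Implicit Types (z w : C).

Lemma cexpD z w : cexp (z + w) = cexp z * cexp w.
Proof.
case: z w => [x y] [u v]; rewrite /cexp /= expRD cosD sinD.
by apply/eqP; rewrite eq_complex /=; apply/andP; split; apply/eqP; ring.
Qed.

Lemma cexpN z : cexp (- z) = (cexp z)^-1.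
Proof.
have E : cexp z * cexp (- z) = 1.
  by rewrite -cexpD subrr /cexp /= expR0 cos0 sin0 mulr0 mulr1.
have z0 : cexp z != 0 by apply: contra_eq_neq E => ->; rewrite mul0r eq_sym oner_eq0.
by apply: (mulfI z0); rewrite E divff.
Qed.

Lemma cexp_neq0 z : cexp z != 0.
Proof.
apply/eqP => z0; have := cexpN (- z); rewrite opprK z0 => /esym/eqP.
rewrite invr_eq0 => /eqP z1; have : cexp (z - z) = 0 by rewrite cexpD z0 mul0r.
by rewrite subrr /cexp /= expR0 cos0 sin0 => /eqP; rewrite eq_complex /= mulr1 oner_eq0.
Qed.

Lemma normc_cexp z : nc (cexp z) = expR (Re z).
Proof.
case: z => x y /=; rewrite !exprMn -mulrDr cos2Dsin2 mulr1 sqrtr_sqr.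
by rewrite ger0_norm ?expR_ge0.
Qed.

Definition decay (zeta : C) (t : R) : C := cexp (- (zeta * t%:C)).

Lemma decay_neq0 zeta t : decay zeta t != 0. Proof. exact: cexp_neq0. Qed.

Lemma normc_decay zeta t : nc (decay zeta t) = expR (- (Re zeta * t)).
Proof. by rewrite normc_cexp; case: zeta => x y /=; rewrite mulr0 subr0. Qed.

Lemma sqmod_decay_lt1 zeta t : 0 < Re zeta -> 0 < t -> sqmod (decay zeta t) < 1.
Proof.
move=> x0 t0; rewrite -normc_lt1 normc_decay -[ltRHS]expR0 ltr_expR oppr_lt0.
exact: mulr_gt0.
Qed.

(** This is [X < sinh X] at [X = Re zeta * t], multiplied by [2 exp (- X)]. *)
Lemma normc_decay_lt zeta t : 0 < Re zeta -> 0 < t ->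
  2 * nc (decay zeta t) * (Re zeta * t) < 1 - sqmod (decay zeta t).
Proof.
move=> x0 t0; have xt := mulr_gt0 x0 t0.
rewrite -normc_sqr normc_decay; set X := _ * t in xt *.
have H := ltr_2x_expR_sub xt.
have E : expR X * expR (- X) = 1 by rewrite -expRD subrr expR0.
have e0 := expR_gt0 (- X).
move: (expR X) (expR (- X)) E e0 H => p q E e0 H.
have : q * (2 * X) < q * (p - q) by rewrite ltr_pM2l.
lra.
Qed.

Lemma Im_le_normc z : `|Im z| <= nc z.
Proof.
rewrite -(ler_pXn2r (n := 2))// ?nnegrE ?normr_ge0 ?normc_ge0//.
by rewrite normc_sqr real_normK ?num_real// lerDr sqr_ge0.
Qed.

(** The quotient [|sin (y t)| / sinh (x t)] is less than [y / x], since
    [|sin u| <= u] and [u < sinh u]. *)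
Lemma Im_decay_lt zeta t : 0 < Re zeta -> 0 < Im zeta -> 0 < t ->
  2 * `|Im (decay zeta t)| * Re zeta < Im zeta * (1 - sqmod (decay zeta t)).
Proof.
move=> x0 y0 t0.
have H := normc_decay_lt x0 t0.
have le : `|Im (decay zeta t)| <= nc (decay zeta t) * (Im zeta * t).
  rewrite normc_decay /decay; case: zeta x0 y0 {H} => x y /= x0 y0.
  rewrite mulr0 subr0 mulr0 add0r sinN mulrN normrN normrM (ger0_norm (expR_ge0 _)).
  rewrite ler_wpM2l ?expR_ge0// (le_trans (normr_sin_le _))// ger0_norm//.
  by rewrite ltW// mulr_gt0.
have n0 := normc_ge0 (decay zeta t).
move: (Re zeta) (Im zeta) x0 y0 H le => x y x0 y0 H le.
have H' : y * (2 * nc (decay zeta t) * (x * t)) < y * (1 - sqmod (decay zeta t)).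
  by rewrite ltr_pM2l.
apply: le_lt_trans H'.
have : `|Im (decay zeta t)| * (2 * x) <= nc (decay zeta t) * (y * t) * (2 * x).
  by rewrite ler_wpM2r// mulr_ge0 ?ltW.
lra.
Qed.

End Cexp.

(** * The interface coefficients *)

Section Coefficients.
Variable R : realType.
Local Notation C := R[i].
Implicit Types (zeta alpha : C) (delta L : R).

(** Impedance reflection coefficient at an interface, damped by crossing the
    overlap [2 delta]. *)
Definition reflection zeta alpha delta : C :=
  (zeta - alpha) / (zeta + alpha) * decay zeta (2 * delta).

Lemma coef_denE zeta alpha delta L : zeta + alpha != 0 ->
  let w := decay zeta L in let g := reflection zeta alpha delta in
  coef_den alpha zeta delta L =
    (zeta + alpha) ^+ 2 * (1 - (g * w) ^+ 2) / (decay zeta (2 * delta) * w).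
Proof.
move=> s0 /=; rewrite /coef_den /reflection.
have -> : cexp (- (zeta * (2 * delta + L)%:C)) = decay zeta (2 * delta) * decay zeta L.
  by rewrite -cexpD rmorphD mulrDr opprD.
have -> : cexp (zeta * (2 * delta + L)%:C) = (decay zeta (2 * delta) * decay zeta L)^-1.
  by rewrite -cexpD -cexpN opprD !opprK rmorphD mulrDr.
have := decay_neq0 zeta (2 * delta); have := decay_neq0 zeta L.
by move: (decay _ _) (decay _ _) => w e w0 e0; field; rewrite s0 w0 e0.
Qed.

Lemma one_sub_sqr_frac_neq0 (u v w e : C) : u != 0 ->
  1 - (v / u * w * e) ^+ 2 != 0 -> u ^+ 2 - (v * w * e) ^+ 2 != 0.
Proof.
move=> u0; have -> : 1 - (v / u * w * e) ^+ 2 = (u ^+ 2 - (v * w * e) ^+ 2) / u ^+ 2.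
  by field.
by rewrite mulf_eq0 negb_or => /andP[].
Qed.

Lemma coef_aE zeta alpha delta L : zeta + alpha != 0 ->
  let w := decay zeta L in let g := reflection zeta alpha delta in
  1 - (g * w) ^+ 2 != 0 ->
  coef_a alpha zeta delta L = w * (1 - g ^+ 2) / (1 - (g * w) ^+ 2).
Proof.
move=> s0 /= d0; rewrite /coef_a coef_denE//.
have e1 : 2 * zeta * delta%:C = zeta * (2 * delta)%:C by rewrite rmorphM rmorph_nat; ring.
rewrite e1 [cexp (zeta * _)](_ : _ = (decay zeta (2 * delta))^-1); last first.
  by rewrite -cexpN opprK.
rewrite -/(decay zeta (2 * delta)).
move: d0; rewrite /reflection.
have := decay_neq0 zeta (2 * delta); have := decay_neq0 zeta L.
move: (decay _ _) (decay _ _) => w e w0 e0 d0; field; rewrite s0 w0 e0 /=.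
rewrite andbT; exact: one_sub_sqr_frac_neq0 s0 d0.
Qed.

Lemma coef_bE zeta alpha delta L : zeta + alpha != 0 ->
  let w := decay zeta L in let g := reflection zeta alpha delta in
  1 - (g * w) ^+ 2 != 0 ->
  coef_b alpha zeta delta L = - (g * (1 - w ^+ 2) / (1 - (g * w) ^+ 2)).
Proof.
move=> s0 /= d0; rewrite /coef_b coef_denE//.
rewrite [cexp (zeta * _)](_ : _ = (decay zeta L)^-1); last first.
  by rewrite -cexpN opprK.
rewrite -/(decay zeta L).
move: d0; rewrite /reflection.
have := decay_neq0 zeta (2 * delta); have := decay_neq0 zeta L.
move: (decay _ _) (decay _ _) => w e w0 e0 d0; field; rewrite s0 w0 e0 /=.
rewrite andbT; exact: one_sub_sqr_frac_neq0 s0 d0.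
Qed.

Lemma one_sub_sqr_neq0 (z : C) : sqmod z < 1 -> 1 - z ^+ 2 != 0.
Proof.
move=> z1; rewrite subr_eq0; apply: contraTneq z1 => /(congr1 (@sqmod R)).
rewrite expr2 sqmodM [X in X = _](_ : _ = 1).
  by move=> h; rewrite -leNgt; have := sqmod_ge0 z; nra.
by rewrite /sqmod /= expr1n expr0n addr0.
Qed.

Lemma sqmodM_lt1 (z w : C) : sqmod z < 1 -> sqmod w < 1 -> sqmod (z * w) < 1.
Proof.
move=> z1 w1; rewrite sqmodM.
by have := sqmod_ge0 z; have := sqmod_ge0 w; nra.
Qed.

(** After division by [(zeta + alpha)^2 exp (zeta (2 delta + L))], the common
    denominator [1 - (g w)^2] factors and one factor cancels in each of the two
    combinations. *)
Lemma coef_add_sub zeta alpha delta L : zeta + alpha != 0 ->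
  let w := decay zeta L in let g := reflection zeta alpha delta in
  sqmod w < 1 -> sqmod g < 1 ->
  coef_a alpha zeta delta L + coef_b alpha zeta delta L = (w - g) / (1 - g * w) /\
  coef_a alpha zeta delta L - coef_b alpha zeta delta L = (w + g) / (1 + g * w).
Proof.
move=> s0 w g w1 g1; have d0 := one_sub_sqr_neq0 (sqmodM_lt1 g1 w1).
rewrite coef_aE// coef_bE// -/w -/g.
have E : 1 - (g * w) ^+ 2 = (1 - g * w) * (1 + g * w) by ring.
move: d0; rewrite E mulf_eq0 negb_or => /andP[dm dp].
by split; field; rewrite dm dp.
Qed.

End Coefficients.

(** * Impedance conditions *)

Section Impedance.
Variables (R : realType) (k x y : R).
Local Notation C := R[i].
Hypotheses (k0 : 0 < k) (x0 : 0 < x) (y0 : 0 < y).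
Let zeta : C := x +i* y.
Let alpha : C := 'i%C * k%:C.
Let s := x ^+ 2 + y ^+ 2.
Let D := x ^+ 2 + (y + k) ^+ 2.

Let D0 : 0 < D.
Proof. by rewrite ltr_pwDl ?exprn_gt0// sqr_ge0. Qed.

Lemma impedance_sum_neq0 : zeta + alpha != 0.
Proof.
rewrite /zeta /alpha eq_complex /= negb_and; apply/orP; left.
by rewrite !mul0r mul1r subr0 !addr0 gt_eqF.
Qed.

Lemma impedance_quotientE :
  (zeta - alpha) / (zeta + alpha) = ((s - k ^+ 2) / D) +i* (- (2 * k * x / D)).
Proof.
apply: (mulIf impedance_sum_neq0); rewrite divfK ?impedance_sum_neq0// /zeta /alpha.
have Dn := lt0r_neq0 D0.
apply/eqP; rewrite eq_complex /= /s; apply/andP.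
by split; apply/eqP; move: Dn; rewrite /D => Dn; field.
Qed.

Let g0 := (zeta - alpha) / (zeta + alpha).

Lemma impedance_quotient_defect :
  [/\ 1 - sqmod g0 = 4 * k * y / D, 1 + sqmod g0 = 2 * (s + k ^+ 2) / D,
      Re g0 = (s - k ^+ 2) / D & `|Im g0| = 2 * k * x / D].
Proof.
have Dn := lt0r_neq0 D0.
rewrite /g0 impedance_quotientE; split=> //=.
- by rewrite /sqmod /=; move: Dn; rewrite /D /s => Dn; field.
- by rewrite /sqmod /=; move: Dn; rewrite /D /s => Dn; field.
- by rewrite normrN ger0_norm// divr_ge0 ?(ltW D0)// !mulr_ge0// ltW.
Qed.

Lemma sqmod_reflection_lt1 delta : 0 < delta -> sqmod (reflection zeta alpha delta) < 1.
Proof.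
move=> d0; apply: sqmodM_lt1; last by apply: sqmod_decay_lt1; rewrite ?mulr_gt0.
have [h _ _ _] := impedance_quotient_defect.
by rewrite -subr_gt0 h divr_gt0// !mulr_gt0.
Qed.

Lemma reflection_neq0 delta : reflection zeta alpha delta != 0.
Proof.
rewrite !mulf_neq0 ?invr_neq0 ?impedance_sum_neq0 ?decay_neq0//.
rewrite eq_complex /= !mul0r mul1r subr0 oppr0 addr0.
by rewrite (gt_eqF x0).
Qed.

(** Call [2 |Im z| / (1 - |z|^2)] the ratio of [z]. The ratio of [g0] is exactly
    [x / y], but that of the damping factor is only known to be less than
    [y / x]. The hypothesis says that [|Re g0| <= (x / y)^2 (1 + |g0|^2) / 2],
    which is what [Im_prod_le] needs to keep the bound [x / y]. *)
Lemma Im_reflection_le_inv delta : 0 < delta ->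
  `|s - k ^+ 2| * y ^+ 2 <= x ^+ 2 * (s + k ^+ 2) ->
  2 * `|Im (reflection zeta alpha delta)| * y <=
    x * (1 - sqmod (reflection zeta alpha delta)).
Proof.
move=> d0 good; have [h1 h2 h3 h4] := impedance_quotient_defect.
have Ie : 2 * `|Im (decay zeta (2 * delta))| * x <
    y * (1 - sqmod (decay zeta (2 * delta))).
  by apply: (@Im_decay_lt R zeta); rewrite ?mulr_gt0.
rewrite -ler_pdivlMr// mulrAC.
apply: Im_prod_le.
  by rewrite -/g0 h1 h4 le_eqVlt; apply/orP; left; apply/eqP; field; rewrite !gt_eqF.
rewrite -/g0 h2 h3 normrM (ger0_norm (x := D^-1)) ?invr_ge0 ?(ltW D0)//.
set e := decay _ _ in Ie *.
have S0 : 0 < 1 - sqmod e by rewrite subr_gt0 sqmod_decay_lt1// mulr_gt0.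
have Ie' : 2 * `|Im e| <= y / x * (1 - sqmod e).
  by rewrite mulrAC ler_pdivlMr// ltW.
have good' : `|s - k ^+ 2| <= x ^+ 2 * (s + k ^+ 2) / y ^+ 2.
  by rewrite ler_pdivlMr// exprn_gt0.
apply: (@le_trans _ _ ((`|s - k ^+ 2| / D) * (y / x * (1 - sqmod e)))).
  by rewrite -mulrA mulrCA ler_wpM2l// divr_ge0// ltW.
have -> : x / y * (2 * (s + k ^+ 2) / D / 2 * (1 - sqmod e)) =
   (x ^+ 2 * (s + k ^+ 2) / y ^+ 2 / D) * (y / x * (1 - sqmod e)).
  by field; rewrite !gt_eqF.
rewrite ler_wpM2r//; first by rewrite mulr_ge0 ?divr_ge0// ltW.
by rewrite ler_wpM2r ?invr_ge0 ?(ltW D0).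
Qed.

(** When [x <= y], the ratio [x / y] of [g0] and that of the damping factor are
    both at most [y / x]. *)
Lemma Im_reflection_le delta : 0 < delta -> x <= y ->
  2 * `|Im (reflection zeta alpha delta)| * x <=
    y * (1 - sqmod (reflection zeta alpha delta)).
Proof.
move=> d0 xy; have [h1 h2 h3 h4] := impedance_quotient_defect.
have Ie : 2 * `|Im (decay zeta (2 * delta))| * x <
    y * (1 - sqmod (decay zeta (2 * delta))).
  by apply: (@Im_decay_lt R zeta); rewrite ?mulr_gt0.
rewrite -ler_pdivlMr// mulrAC.
apply: Im_prod_le.
  rewrite -/g0 h1 h4.
  have -> : 2 * (2 * k * x / D) = 4 * k * x * x / x / D by field; rewrite !gt_eqF.
  have -> : y / x * (4 * k * y / D) = 4 * k * y * y / x / D by field; rewrite !gt_eqF.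
  rewrite !ler_pM2r ?invr_gt0//.
  by rewrite -!(mulrA (4 * k)) ler_pM2l ?mulr_gt0// ler_pM// ltW.
set e := decay _ _ in Ie *.
have Ie' : 2 * `|Im e| <= y / x * (1 - sqmod e) by rewrite mulrAC ler_pdivlMr// ltW.
have re : `|Re g0| <= (1 + sqmod g0) / 2.
  have : `|Re g0| ^+ 2 <= sqmod g0 by rewrite /sqmod real_normK ?num_real// lerDl sqr_ge0.
  have := sqr_ge0 (`|Re g0| - 1); lra.
rewrite -/g0 -mulrA mulrCA [leRHS]mulrCA; apply: ler_pM => //; exact: mulr_ge0.
Qed.

Variables (delta L : R).
Hypotheses (d0 : 0 < delta) (L0 : 0 < L).
Let w := decay zeta L.
Let g := reflection zeta alpha delta.
Let a := coef_a alpha zeta delta L.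
Let b := coef_b alpha zeta delta L.

Let w1 : sqmod w < 1. Proof. exact: sqmod_decay_lt1. Qed.
Let g1 : sqmod g < 1. Proof. exact: sqmod_reflection_lt1. Qed.

Lemma coef_a_neq0 : a != 0.
Proof.
have d := one_sub_sqr_neq0 (sqmodM_lt1 g1 w1).
rewrite /a coef_aE ?impedance_sum_neq0//.
apply: mulf_neq0; rewrite ?invr_neq0//.
by apply: mulf_neq0; rewrite ?decay_neq0 ?one_sub_sqr_neq0.
Qed.

Lemma coef_b_neq0 : b != 0.
Proof.
have d := one_sub_sqr_neq0 (sqmodM_lt1 g1 w1).
rewrite /b coef_bE ?impedance_sum_neq0// oppr_eq0.
apply: mulf_neq0; rewrite ?invr_neq0//.
by apply: mulf_neq0; rewrite ?reflection_neq0 ?one_sub_sqr_neq0.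
Qed.

(** [a + b] and [a - b] are exchanged by [g -> - g], which changes neither side
    of the criterion that the product of the ratios of [w] and [g] is less
    than 1. *)
Lemma mode_radius_coef_lt1 :
  (2 * `|Im w|) * (2 * `|Im g|) < (1 - sqmod w) * (1 - sqmod g) ->
  mode_radius a b < 1.
Proof.
move=> lt; have [e1 e2] := coef_add_sub impedance_sum_neq0 w1 g1.
rewrite /mode_radius e1 e2 gt_max; apply/andP; split.
  by apply: blaschke_lt1 => //; apply: le_lt_trans lt; lra.
rewrite -[reflection _ _ _]opprK mulNr -/g.
have sN : sqmod (- g) = sqmod g.
  by rewrite -mulN1r sqmodM /sqmod /= oppr0 expr0n addr0 sqrrN expr1n mul1r.
have iN : `|Im (- g)| = `|Im g| by case: (g) => ? ? /=; rewrite normrN.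
apply: blaschke_lt1 => //; first by rewrite sN.
by rewrite sN iN; apply: le_lt_trans lt; lra.
Qed.

Let Iw : 2 * `|Im w| * x < y * (1 - sqmod w).
Proof. exact: (@Im_decay_lt R zeta L). Qed.

(** The ratio of [w] is less than [y / x], that of [g] at most [x / y]. *)
Lemma mode_radius_lt1_balanced :
  `|s - k ^+ 2| * y ^+ 2 <= x ^+ 2 * (s + k ^+ 2) -> mode_radius a b < 1.
Proof.
move=> /(Im_reflection_le_inv d0) Ig; apply: mode_radius_coef_lt1.
have S1 : 0 < 1 - sqmod g by rewrite subr_gt0.
have A0 : 0 <= 2 * `|Im w| * x by rewrite !mulr_ge0// ltW.
rewrite -(ltr_pM2r (mulr_gt0 x0 y0)).
apply: (@le_lt_trans _ _ ((2 * `|Im w| * x) * (x * (1 - sqmod g)))).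
  by rewrite mulrACA; apply: ler_wpM2l.
have : (2 * `|Im w| * x) * (x * (1 - sqmod g)) <
       (y * (1 - sqmod w)) * (x * (1 - sqmod g)).
  by rewrite ltr_pM2r// mulr_gt0.
by move/lt_le_trans; apply; rewrite le_eqVlt; apply/orP; left; apply/eqP; ring.
Qed.

(** The ratio of [w] is less than [1 / (x L)], that of [g] at most [y / x]. *)
Lemma mode_radius_lt1_large_L : x <= y -> y < x ^+ 2 * L -> mode_radius a b < 1.
Proof.
move=> /(Im_reflection_le d0) Ig big; apply: mode_radius_coef_lt1.
have Hw : 2 * nc w * (x * L) < 1 - sqmod w by exact: (@normc_decay_lt R zeta).
have Iw' : 2 * `|Im w| * (x * L) < 1 - sqmod w.
  apply: le_lt_trans Hw; rewrite ler_wpM2r ?mulr_ge0 ?(ltW x0) ?(ltW L0)//.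
  by rewrite ler_wpM2l// Im_le_normc.
have S1 : 0 < 1 - sqmod g by rewrite subr_gt0.
have S2 : 0 < 1 - sqmod w by rewrite subr_gt0.
have p0 : 0 < x * L * x by rewrite !mulr_gt0.
rewrite -(ltr_pM2r p0).
apply: (@le_lt_trans _ _ ((1 - sqmod w) * (y * (1 - sqmod g)))).
  rewrite mulrACA; apply: ler_pM; rewrite ?(ltW Iw')//.
  - by rewrite !mulr_ge0// ltW.
  - by rewrite !mulr_ge0// ltW.
have h : 0 < (1 - sqmod w) * (1 - sqmod g) by exact: mulr_gt0.
rewrite mulrCA mulrC ltr_pM2l//; apply: lt_le_trans big _.
by rewrite le_eqVlt; apply/orP; left; apply/eqP; ring.
Qed.

(** The ratio of [w] is less than [y / x], that of [g] at most
    [1 / (2 delta x)] because [|g| <= exp (- 2 delta x)]. *)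
Lemma mode_radius_lt1_large_delta : y <= x * (2 * delta * x) -> mode_radius a b < 1.
Proof.
move=> big; apply: mode_radius_coef_lt1.
set e := decay zeta (2 * delta).
have d20 : 0 < 2 * delta by rewrite mulr_gt0.
have He : 2 * nc e * (x * (2 * delta)) < 1 - sqmod e by exact: (@normc_decay_lt R zeta).
have [h1 _ _ _] := impedance_quotient_defect.
have q1 : sqmod g0 <= 1 by rewrite -subr_ge0 h1 divr_ge0 ?(ltW D0)// !mulr_ge0// ltW.
have ge : sqmod g <= sqmod e by rewrite /g sqmodM ler_piMl// sqmod_ge0.
have gne : nc g <= nc e.
  by rewrite -(ler_pXn2r (n := 2))// ?nnegrE ?normc_ge0// !normc_sqr.
have X0 : 0 < x * (2 * delta) by rewrite mulr_gt0.
have Ig : 2 * `|Im g| * (x * (2 * delta)) <= 1 - sqmod g.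
  apply: (@le_trans _ _ (1 - sqmod e)); last by rewrite lerD2l lerN2.
  apply: le_trans (ltW He); rewrite ler_wpM2r ?(ltW X0)//.
  by rewrite ler_wpM2l// (le_trans (Im_le_normc _)).
have S1 : 0 < 1 - sqmod g by rewrite subr_gt0.
have p0 : 0 < x * (x * (2 * delta)) by rewrite mulr_gt0.
rewrite -(ltr_pM2r p0).
apply: (@le_lt_trans _ _ ((2 * `|Im w| * x) * (1 - sqmod g))).
  by rewrite mulrACA; apply: ler_wpM2l => //; rewrite !mulr_ge0// ltW.
apply: (@lt_le_trans _ _ ((y * (1 - sqmod w)) * (1 - sqmod g))).
  by rewrite ltr_pM2r.
rewrite -mulrA mulrC ler_wpM2l//; first by rewrite mulr_ge0 ?(ltW S1)// subr_ge0 ltW.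
by apply: le_trans big _; rewrite le_eqVlt; apply/orP; left; apply/eqP; ring.
Qed.

(** Then [|w|] and [|g|] are at most [1 / 5], by [5 <= 1 + X <= exp X] at
    [X = x L] and [X = 2 delta x], and [(2 / 5) / (24 / 25) <= 1 / 2]. *)
Lemma mode_radius_le_half : 4 <= x * L -> 4 <= x * (2 * delta) ->
  mode_radius a b <= 1 / 2.
Proof.
move=> xL xd.
have [e1 e2] := coef_add_sub impedance_sum_neq0 w1 g1.
have decay_le t : 4 <= x * t -> nc (decay zeta t) <= 1 / 5.
  move=> xt; rewrite normc_decay expRN /zeta /= div1r lef_pV2 ?posrE ?expR_gt0//.
  by apply: le_trans (expR_ge1Dx _); lra.
have w5 : nc w <= 1 / 5 by exact: decay_le.
have g5 : nc g <= 1 / 5.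
  apply: le_trans (decay_le _ xd); rewrite /g Normc.normcM ler_piMl ?normc_ge0//.
  have [h1 _ _ _] := impedance_quotient_defect.
  rewrite -(expr_le1 (n := 2)) ?normc_ge0// normc_sqr -subr_ge0 h1.
  by rewrite divr_ge0 ?(ltW D0)// !mulr_ge0// ltW.
have half (h : C) : nc h <= 1 / 5 -> nc ((w - h) / (1 - h * w)) <= 1 / 2.
  move=> h5.
  have den : 24 / 25 <= nc (1 - h * w).
    have : nc 1 <= nc (1 - h * w) + nc (h * w).
      by apply: le_trans (normcD_le _ _); rewrite subrK.
    rewrite Normc.normcM Normc.normc1.
    have : nc h * nc w <= 1 / 5 * (1 / 5) by apply: ler_pM; rewrite ?normc_ge0.
    lra.
  rewrite Normc.normcM Normc.normcV ler_pdivrMr; last by lra.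
  have := normcD_le w (- h); rewrite normcN; lra.
rewrite /mode_radius e1 e2 ge_max; apply/andP; split; first exact: half.
by rewrite -[reflection _ _ _]opprK mulNr half// normcN.
Qed.

End Impedance.

(** * Limits and suprema over the Fourier modes *)

Section Modes.
Variable R : realType.
Implicit Types k sigma delta L kt Lhat K : R.

Lemma sqrtc_quadrant1 (c : R[i]) : 0 <= Im c ->
  0 <= Re (sqrtc c) /\ 0 <= Im (sqrtc c).
Proof.
case: c => p q /= q0; split; first exact: sqrtr_ge0.
by rewrite mulr_ge0 ?sqrtr_ge0//; case: eqP => // _; rewrite sgr_ge0.
Qed.

Lemma le_of_sqr (x y : R) : 0 <= y -> x ^+ 2 <= y ^+ 2 -> x <= y.
Proof. by move=> y0 xy; rewrite leNgt; apply/negP => yx; nra. Qed.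

Lemma zeta_ofP k sigma kt : 0 < k * sigma ->
  exists x y, [/\ zeta_of k sigma kt = x +i* y, 0 < x, 0 < y,
                  x ^+ 2 - y ^+ 2 = kt ^+ 2 - k ^+ 2 & 2 * x * y = k * sigma].
Proof.
move=> ks0; set z := zeta_of k sigma kt.
have z2 : z ^+ 2 = (kt ^+ 2 - k ^+ 2) +i* (k * sigma).
  rewrite sqr_sqrtc; apply/eqP; rewrite eq_complex /=; apply/andP.
  by split; apply/eqP; ring.
have [zx zy] : 0 <= Re z /\ 0 <= Im z.
  apply: sqrtc_quadrant1 => /=; move: ks0; lra.
move: z2 zx zy; case: z => x y /= /eqP; rewrite eq_complex /=.
move=> /andP[/eqP e1 /eqP e2] zx zy.
have xy : 2 * x * y = k * sigma by rewrite -e2; ring.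
have x0 : x != 0 by apply: contraTneq ks0 => x0; rewrite -xy x0; lra.
have y0 : y != 0 by apply: contraTneq ks0 => y0; rewrite -xy y0; lra.
by exists x, y; split; rewrite ?lt0r ?x0 ?y0// -e1; ring.
Qed.

Definition impedance_radius k sigma delta L kt : R :=
  let zeta := zeta_of k sigma kt in let alpha := 'i%C * k%:C in
  mode_radius (coef_a alpha zeta delta L) (coef_b alpha zeta delta L).

Lemma conv_factor_le k sigma delta L kt N :
  conv_factor ('i%C * k%:C) k sigma delta L kt N <= impedance_radius k sigma delta L kt.
Proof. exact: spectral_radius_schwarz_mx_le. Qed.

Lemma cvg_conv_factor k sigma delta L kt :
  0 < k -> 0 < sigma -> 0 < delta -> 0 < L ->
  conv_factor ('i%C * k%:C) k sigma delta L kt N @[N --> \oo] -->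
  impedance_radius k sigma delta L kt.
Proof.
move=> k0 s0 d0 L0; have [x [y [zE x0 y0 _ _]]] := zeta_ofP kt (mulr_gt0 k0 s0).
rewrite -cvg_shiftS /impedance_radius /conv_factor /T1d zE.
by apply: cvg_spectral_radius_schwarz_mx; [exact: coef_a_neq0|exact: coef_b_neq0].
Qed.

Lemma R1dE k sigma delta L kt :
  0 < k -> 0 < sigma -> 0 < delta -> 0 < L ->
  R1d ('i%C * k%:C) k sigma delta L kt = impedance_radius k sigma delta L kt.
Proof. by move=> k0 s0 d0 L0; apply: cvg_lim => //; exact: cvg_conv_factor. Qed.

(** Here [y < x], and [| |zeta|^2 - k^2 | <= |zeta|^2 + k^2] always. *)
Lemma impedance_radius_evanescent k sigma delta L kt :
  0 < k -> 0 < sigma -> 0 < delta -> 0 < L -> k < kt ->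
  impedance_radius k sigma delta L kt < 1.
Proof.
move=> k0 s0 d0 L0 kkt; have [x [y [zE x0 y0 e1 _]]] := zeta_ofP kt (mulr_gt0 k0 s0).
rewrite /impedance_radius zE; apply: mode_radius_lt1_balanced => //.
have yx : y ^+ 2 <= x ^+ 2 by rewrite -subr_ge0 e1; nra.
have := sqr_ge0 x; have := sqr_ge0 y; have := sqr_ge0 k.
move: (x ^+ 2) (y ^+ 2) (k ^+ 2) yx => X Y K YX K0 Y0 X0.
have : `|X + Y - K| <= X + Y + K by rewrite ler_norml; lra.
by move=> h; rewrite mulrC ler_pM// ?normr_ge0.
Qed.

(** From [2 x y = k sigma >= k^2] follows [|zeta|^2 >= k^2]; the
    hypothesis of [mode_radius_lt1_balanced] then reads [y^2 - x^2 <= k^2], and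
    [y^2 - x^2 = k^2 - kt^2]. *)
Lemma impedance_radius_absorbing k sigma delta L kt :
  0 < k -> 0 < delta -> 0 < L -> k <= sigma ->
  impedance_radius k sigma delta L kt < 1.
Proof.
move=> k0 d0 L0 ks; have s0 := lt_le_trans k0 ks.
have [x [y [zE x0 y0 e1 e2]]] := zeta_ofP kt (mulr_gt0 k0 s0).
rewrite /impedance_radius zE; apply: mode_radius_lt1_balanced => //.
have ss : k ^+ 2 <= x ^+ 2 + y ^+ 2.
  have : k ^+ 2 <= 2 * x * y by rewrite e2 expr2 ler_pM2l.
  have := sqr_ge0 (x - y); lra.
rewrite ger0_norm ?subr_ge0// -subr_ge0.
have -> : x ^+ 2 * (x ^+ 2 + y ^+ 2 + k ^+ 2) - (x ^+ 2 + y ^+ 2 - k ^+ 2) * y ^+ 2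
  = (x ^+ 2 + y ^+ 2) * (k ^+ 2 + (x ^+ 2 - y ^+ 2)) by ring.
rewrite e1 mulr_ge0//; first by rewrite addr_ge0 ?sqr_ge0.
by rewrite addrC subrK sqr_ge0.
Qed.

(** For propagating modes with [sigma0 <= sigma <= k], the relations
    [y^2 - x^2 <= k^2] and [2 x y = k sigma] give [x <= y <= 2 k] and
    [sigma0 / 4 <= x], uniformly in the mode. *)
Lemma impedance_radius_propagative k sigma0 sigma delta L kt :
  0 < k -> 0 < sigma0 -> sigma0 <= sigma -> sigma <= k -> 0 < delta -> 0 < L ->
  0 <= kt -> kt <= k ->
  32 * k < sigma0 ^+ 2 * L \/ 32 * k < sigma0 ^+ 2 * delta ->
  impedance_radius k sigma delta L kt < 1.
Proof.
move=> k0 s00 s0s sk d0 L0 kt0 ktk big; have s0 := lt_le_trans s00 s0s.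
have [x [y [zE x0 y0 e1 e2]]] := zeta_ofP kt (mulr_gt0 k0 s0).
have kt2 : kt ^+ 2 <= k ^+ 2 by rewrite ler_pXn2r ?nnegrE// ltW.
have xy : x <= y by apply: le_of_sqr; [exact: ltW|lra].
have y2k : y <= 2 * k.
  have k2 : 2 * x * y <= k ^+ 2 by rewrite e2 expr2 ler_pM2l.
  have kt20 := sqr_ge0 kt.
  have x2 : x ^+ 2 <= x * y by rewrite expr2 ler_pM2l.
  by apply: le_of_sqr; [lra|rewrite exprMn; lra].
have x4 : sigma0 <= 4 * x.
  rewrite -(ler_pM2l k0).
  have : k * sigma0 <= k * sigma by rewrite ler_pM2l.
  have : x * y <= x * (2 * k) by rewrite ler_pM2l.
  rewrite -e2; lra.
have x16 : sigma0 ^+ 2 <= 16 * x ^+ 2.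
  have -> : 16 * x ^+ 2 = (4 * x) ^+ 2 by ring.
  by rewrite ler_pXn2r ?nnegrE ?(ltW s00)//; lra.
have grow t : 0 < t -> 32 * k < sigma0 ^+ 2 * t -> y < x ^+ 2 * t.
  move=> t0 bt; have : sigma0 ^+ 2 * t <= 16 * x ^+ 2 * t by rewrite ler_pM2r.
  lra.
rewrite /impedance_radius zE; case: big => [/(grow _ L0)|/(grow _ d0)] big.
  exact: mode_radius_lt1_large_L.
by apply: mode_radius_lt1_large_delta => //; have := mulr_gt0 (exprn_gt0 2 x0) d0; lra.
Qed.

(** [x^2 >= kt^2 - k^2] grows with the Fourier number, so [w] and [g] decay. *)
Lemma impedance_radius_high k sigma delta L :
  0 < k -> 0 < sigma -> 0 < delta -> 0 < L ->
  exists K, forall kt, K <= kt -> impedance_radius k sigma delta L kt <= 1 / 2.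
Proof.
move=> k0 s0 d0 L0; pose c := Num.max (4 / L) (2 / delta).
have c0 : 0 < c by rewrite lt_max divr_gt0.
exists (k + c) => kt Kkt; have [x [y [zE x0 y0 e1 _]]] := zeta_ofP kt (mulr_gt0 k0 s0).
have cx : c <= x.
  apply: le_of_sqr; first exact: ltW.
  have : (k + c) ^+ 2 <= kt ^+ 2.
    by rewrite ler_pXn2r ?nnegrE//; lra.
  have := mulr_gt0 k0 c0; have := sqr_ge0 y; lra.
rewrite /impedance_radius zE; apply: mode_radius_le_half => //.
  by rewrite -ler_pdivrMr//; apply: le_trans cx; rewrite le_max lexx.
have : 2 / delta <= x by apply: le_trans cx; rewrite le_max lexx orbT.
by rewrite ler_pdivrMr//; lra.
Qed.

Lemma fourier_number_large Lhat K : 0 < Lhat ->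
  \forall m \near \oo, K <= fourier_number Lhat m.
Proof.
move=> l0; near=> m; rewrite /fourier_number -mulrA -ler_pdivrMr ?divr_gt0 ?pi_gt0//.
by rewrite ltW//; near: m; exact: nbhs_infty_gtr.
Unshelve. all: by end_near. Qed.

Lemma uniform_bound_lt1 (f : nat -> R) :
  (forall m, (0 < m)%N -> f m < 1) -> (\forall m \near \oo, f m <= 1 / 2) ->
  exists2 q : R, q < 1 & forall m, (0 < m)%N -> f m <= q.
Proof.
move=> f1 [M _ fM]; pose F i := if (0 < i)%N then f i else 0.
exists (\big[Num.max/1 / 2]_(i < M) F i).
  apply: bigmax_lt => [|i _]; first lra.
  by rewrite /F; case: ifP => [/f1//|_]; lra.
move=> m m0; case: (ltnP m M) => [mM|/fM/= /le_trans->//]; last first.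
  exact: bigmax_ge_id.
by apply: le_trans (le_bigmax _ _ (Ordinal mM)); rewrite /F m0.
Qed.

Lemma R2d_lt1 k sigma delta L Lhat :
  0 < k -> 0 < sigma -> 0 < delta -> 0 < L -> 0 < Lhat ->
  (forall m, (0 < m)%N -> impedance_radius k sigma delta L (fourier_number Lhat m) < 1) ->
  (R2d ('i%C * k%:C)%R k sigma delta L Lhat < 1)%E.
Proof.
move=> k0 s0 d0 L0 l0 lt1.
have [K hK] := impedance_radius_high k0 s0 d0 L0.
have [|q q1 hq] := uniform_bound_lt1 lt1.
  by apply: filterS (fourier_number_large K l0) => m /hK.
apply: (@le_lt_trans _ _ q%:E); last by rewrite lte_fin.
apply: ge_ereal_sup => _ [m /= m0 <-]; rewrite lee_fin R1dE//; exact: hq.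
Qed.

(** The bound [conv_factor_le] holds for each number of subdomains and not only
    in the limit, so the supremum itself is a uniform contraction factor. *)
Lemma R2d_scales k sigma delta L Lhat :
  0 < k -> 0 < sigma -> 0 < delta -> 0 < L ->
  (R2d ('i%C * k%:C)%R k sigma delta L Lhat < 1)%E ->
  schwarz_scales ('i%C * k%:C) k sigma delta L Lhat.
Proof.
move=> k0 s0 d0 L0; set r := R2d _ _ _ _ _ _ => r1.
have le_r m : (0 < m)%N ->
    ((impedance_radius k sigma delta L (fourier_number Lhat m))%:E <= r)%E.
  by move=> m0; rewrite -R1dE//; apply: ereal_sup_ubound; exists m.
have rfin : r \is a fin_num.
  rewrite fin_numElt (lt_trans r1 (ltry _)) andbT.
  by apply: lt_le_trans (le_r 1%N isT); rewrite ltNyr.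
exists (fine r); first by rewrite -lte_fin fineK.
near=> N => m m0; apply: le_trans (conv_factor_le _ _ _ _ _ _) _.
by rewrite -lee_fin fineK// le_r.
Unshelve. all: by end_near. Qed.

Lemma fourier_number_ge0 Lhat m : 0 < Lhat -> 0 <= fourier_number Lhat m.
Proof. by move=> l0; rewrite divr_ge0 ?(ltW l0)// mulr_ge0// pi_ge0. Qed.

End Modes.

Theorem theorem4p1 (R : realType) (k Lhat : R) (alpha : R[i])
    (hk : 0 < k) (hLhat : 0 < Lhat) (halpha : alpha = 'i%C * k%:C) :
  [/\ (* the limits defining R1d exist *)
      forall sigma delta L : R, 0 < sigma -> 0 < delta -> 0 < L ->
        forall m : nat, (0 < m)%N ->
          cvgn (conv_factor alpha k sigma delta L (fourier_number Lhat m)),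
      (* evanescent modes *)
      forall sigma delta L : R, 0 < sigma -> 0 < delta -> 0 < L ->
        forall m : nat, (0 < m)%N -> k < fourier_number Lhat m ->
          R1d alpha k sigma delta L (fourier_number Lhat m) < 1,
      (* sigma, delta and L sufficiently large between them *)
      forall sigma0 : R, 0 < sigma0 ->
        exists M : R, forall sigma delta L : R,
          sigma0 <= sigma -> 0 < delta -> 0 < L -> M <= sigma + delta + L ->
          (R2d alpha k sigma delta L Lhat < 1)%E,
      forall sigma delta L : R, 0 < sigma -> 0 < delta -> 0 < L -> k <= sigma ->
        (R2d alpha k sigma delta L Lhat < 1)%E
    & forall sigma delta L : R, 0 < sigma -> 0 < delta -> 0 < L ->
        (R2d alpha k sigma delta L Lhat < 1)%E ->
        schwarz_scales alpha k sigma delta L Lhat].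
Proof.
rewrite {alpha}halpha; split.
- move=> sigma delta L s0 d0 L0 m _; apply/cvg_ex.
  exists (impedance_radius k sigma delta L (fourier_number Lhat m)).
  exact: cvg_conv_factor.
- move=> sigma delta L s0 d0 L0 m _ km; rewrite R1dE//.
  exact: impedance_radius_evanescent.
(* If sigma < k, then delta + L > 2 T, so that delta or L is at least T, and
   sigma0^2 T = 32 k + sigma0^2 exceeds the threshold for propagating modes. *)
- move=> sigma0 s00; pose T := 32 * k / sigma0 ^+ 2 + 1.
  exists (k + 2 * T) => sigma delta L s0s d0 L0 big.
  have s0 := lt_le_trans s00 s0s.
  apply: R2d_lt1 => // m m0.
  case: (leP k sigma) => [ks|sk]; first exact: impedance_radius_absorbing.
  case: (leP (fourier_number Lhat m) k) => [mk|km]; last first.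
    exact: impedance_radius_evanescent.
  apply: (impedance_radius_propagative _ s00 s0s (ltW sk) _ _ _ mk) => //.
    exact: fourier_number_ge0.
  have grow t : T <= t -> 32 * k < sigma0 ^+ 2 * t.
    move=> Tt; rewrite [ltRHS]mulrC -ltr_pdivrMr ?exprn_gt0//.
    by apply: lt_le_trans Tt; rewrite /T ltrDl.
  have [/grow|/grow] : T <= L \/ T <= delta by case: (leP T L) => h; [left|right]; lra.
    by left.
  by right.
- move=> sigma delta L s0 d0 L0 ks; apply: R2d_lt1 => // m _.
  exact: impedance_radius_absorbing.
- by move=> sigma delta L s0 d0 L0; exact: R2d_scales.
Qed.
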